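(* Let $m\in\mathfrak{sl}_2(F)$ and let $W$ be an irreducible smooth representation of $Z_G(m)$. If $v(\det(m))\ge 1$, then the operator by which $T_x$ acts on $V_{m,W}^{K_\epsilon}$ does not depend on $x\in\kappa$.
   Context: $F$ is a non-Archimedean local field of characteristic different from $2$, $\mathcal{O}$ its ring of integers, $\varpi$ a generator of the maximal ideal, $v$ the valuation of $F$ (with $v(0)=\infty$), $\kappa=\mathcal{O}/\varpi\mathcal{O}$, $q=|\kappa|$. For a ring $A$, $A_\epsilon:=A[\epsilon]/(\epsilon^2)$. Put $G=\mathrm{PGL}_2(F)$, $G_\epsilon=\mathrm{PGL}_2(F_\epsilon)$, $K_\epsilon=\mathrm{PGL}_2(\mathcal{O}_\epsilon)$, $\mathfrak{g}=\mathfrak{sl}_2(F)$. Elements of $\mathrm{PGL}_2$ are written as matrices in $\mathrm{GL}_2$. One has $G_\epsilon=(1+\epsilon\mathfrak{g})\rtimes G$. For $x\in\kappa$ with a lift $\tilde x\in\mathcal{O}$, let $g_x=\begin{pmatrix}\varpi+\epsilon\tilde x&0\\0&1\end{pmatrix}\in G_\epsilon$; the double coset $K_\epsilon g_xK_\epsilon$ does not depend on the lift. $T_x:=q^{-1}\,\mathrm{ch}_{K_\epsilon g_xK_\epsilon}$ in the Hecke algebra of $(G_\epsilon,K_\epsilon)$ (Haar measure with $\mathrm{vol}(K_\epsilon)=1$); on the $K_\epsilon$-invariants $V^{K_\epsilon}$ of a smooth representation $V$ of $G_\epsilon$ it acts by $T_xv=q^{-1}\sum_{gK_\epsilon\subset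 K_\epsilon g_xK_\epsilon}gv$. Fix an additive character $\psi_0:F\to\mathrm{U}(1)$ with $\{x\in F:\psi_0|_{x\mathcal{O}}=1\}=\mathcal{O}$, and for $m\in\mathfrak{g}$ let $\psi_m(m')=\psi_0(\mathrm{tr}(mm'))$. $Z_G(m)$ is the stabilizer of $m$ in $G$ under conjugation. $V_{m,W}$ is the space of smooth functions $f:G_\epsilon\to W$ such that $f((1+\epsilon m')g)=\psi_m(m')f(g)$ for $m'\in\mathfrak{g}$, $g\in G$; $f(zg)=z f(g)$ for $z\in Z_G(m)$, $g\in G$; and the support of $f|_G$ is compact modulo left translation by $Z_G(m)$. $G_\epsilon$ acts by right translation. *)

(* Defs.v *)
From HB Require Import structures.
From mathcomp Require Import all_boot all_order all_algebra ring_quotient finmap.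
From mathcomp Require Import all_classical all_reals all_analysis.
From mathcomp Require Import complex.
Set Implicit Arguments.
Unset Strict Implicit.
Unset Printing Implicit Defensive.
Import Order.TTheory GRing.Theory Num.Theory.
Import numFieldNormedType.Exports.
Local Open Scope classical_set_scope.
Local Open Scope ring_scope.
Local Open Scope quotient_scope.

#[short(type="topComUnitRingType")]
HB.structure Definition TopComUnitRing :=
  {A of GRing.ComUnitRing A & Topological A}.

(* The topology is part of the structure, and is required to be the one defined
   by the valuation, which is normalized and takes the value +oo exactly at 0.
   Every residue class of the valuation ring modulo its maximal ideal is
   represented in the finite sequence of residue_finite. *)
HB.mixin Record isNonarchLocal F of GRing.Field F & Topological F := {
  valuation : F -> \bar int;
  valuation_neqNy : forall x, valuation x != -oo%E;
  valuation_eqy : forall x, (valuation x == +oo%E) = (x == 0);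
  valuationM : forall x y, valuation (x * y) = (valuation x + valuation y)%E;
  valuationD : forall x y,
    (Order.min (valuation x) (valuation y) <= valuation (x + y)%R)%E;
  valuation_normalized : exists x, valuation x = 1%:E;
  valuation_nbhs : forall (x : F) (A : set F), nbhs x A <->
    exists n : int, [set y | (n%:E <= valuation (y - x)%R)%E] `<=` A;
  valuation_complete : forall u : nat -> F,
    (forall n : int, exists N : nat, forall i j, (N <= i)%N -> (N <= j)%N ->
       (n%:E <= valuation (u i - u j)%R)%E) ->
    exists l : F, u @ \oo --> l;
  residue_finite : exists s : seq F, forall x, (0 <= valuation x)%E ->
    exists2 y, y \in s & (1%:E <= valuation (x - y)%R)%E
}.

#[short(type="localFieldType")]
HB.structure Definition NonarchLocalField :=
  {F of isNonarchLocal F & GRing.Field F & Topological F}.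

Section ValuationTheory.
Variable F : localFieldType.
Implicit Types x y : F.
Local Notation v := (@valuation F).

Lemma valuation0 : v 0 = +oo%E.
Proof. by apply/eqP; rewrite valuation_eqy. Qed.

Lemma valuation1 : v 1 = 0%E.
Proof.
have := valuationM (1 : F) 1; rewrite mulr1.
have := valuation_neqNy (1 : F); have := valuation_eqy (1 : F).
rewrite oner_eq0; case: (v 1) => // r _ _ [] /eqP.
by rewrite -subr_eq0 opprD addNKr oppr_eq0 => /eqP ->.
Qed.

Lemma valuationN x : v (- x) = v x.
Proof.
rewrite -mulN1r valuationM.
have : v (-1) = 0%E.
  have := valuationM (-1 : F) (-1); rewrite mulrNN mulr1 valuation1.
  case: (v (-1)) => // r [] /esym; move=> h; congr (_%:E).
  by move: h => /eqP; rewrite -mulr2n mulrn_eq0 => /eqP.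
by move=> ->; rewrite add0e.
Qed.

Lemma valuationB x y (n : \bar int) :
  (n <= v x)%E -> (n <= v y)%E -> (n <= v (x - y)%R)%E.
Proof.
move=> nx ny; apply: le_trans (valuationD x (- y)).
by rewrite valuationN le_min nx ny.
Qed.

End ValuationTheory.

Section ResidueField.
Variable F : localFieldType.

Definition valring_pred : pred F := fun x => (0 <= valuation x)%E.

Lemma valring_subring : subring_closed valring_pred.
Proof.
split=> [|x y|x y]; rewrite -!topredE /= /valring_pred.
- by rewrite valuation1.
- exact: valuationB.
- by rewrite valuationM; exact: adde_ge0.
Qed.

HB.instance Definition _ :=
  GRing.isSubringClosed.Build F valring_pred valring_subring.

Definition valring := {x : F | valring_pred x}.
HB.instance Definition _ := SubChoice.on valring.
HB.instance Definition _ := [SubChoice_isSubComNzRing of valring by <:].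

Definition maxideal : pred valring := fun x => (1%:E <= valuation (\val x))%E.

Lemma maxideal_idealr : idealr_closed maxideal.
Proof.
split.
- by rewrite -topredE /= /maxideal valuation0 leey.
- by rewrite -topredE /= /maxideal valuation1 lee_fin.
- move=> a x y; rewrite -!topredE /= /maxideal => hx hy.
  rewrite rmorphD rmorphM -[X in _ + X]opprK; apply: valuationB.
    rewrite valuationM -[X in (X <= _)%E]add0e; apply: leeD => //.
    exact: (valP a).
  by rewrite valuationN.
Qed.

HB.instance Definition _ := isIdealr.Build valring maxideal maxideal_idealr.

Definition residue_field := {ideal_quot (maxideal : idealr valring)}.

Definition residue_card : nat := #|` fset_set [set: residue_field]|.

Definition uniformizer (p : F) : Prop :=
  forall x : F, (1%:E <= valuation x)%E <->
    exists2 y : F, (0 <= valuation y)%E & x = p * y.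

End ResidueField.

(* (a, b) stands for a + eps b. *)
Definition dualnum (A : Type) : Type := (A * A)%type.

Section DualNumbers.
Variable A : comUnitRingType.
Local Notation D := (dualnum A).

HB.instance Definition _ := GRing.Zmodule.copy D (A * A)%type.

Definition dual_one : D := (1, 0).
Definition dual_mul (x y : D) : D := (x.1 * y.1, x.1 * y.2 + x.2 * y.1).
Definition dual_unit : pred D := fun x => x.1 \is a GRing.unit.
Definition dual_inv (x : D) : D :=
  if dual_unit x then (x.1^-1, - (x.1^-1 * x.1^-1 * x.2)) else x.

Fact dual_mulA : associative dual_mul.
Proof.
move=> [a b] [c d] [e f]; congr pair; rewrite /= ?mulrA //.
by rewrite mulrDl mulrDr !mulrA addrA.
Qed.
Fact dual_mulC : commutative dual_mul.
Proof.
move=> [a b] [c d]; congr pair; rewrite /= 1?mulrC //.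
by rewrite addrC [c * b]mulrC [d * a]mulrC.
Qed.
Fact dual_mul1 : left_id dual_one dual_mul.
Proof. by move=> [a b]; congr pair; rewrite /= !mul1r // mul0r addr0. Qed.
Fact dual_mulD : left_distributive dual_mul +%R.
Proof.
move=> [a b] [c d] [e f]; congr pair; rewrite /= mulrDl //.
by rewrite [_ * e]mulrDl addrACA.
Qed.
Fact dual_one_neq0 : dual_one != 0.
Proof. by apply/eqP => /(congr1 fst) /= /eqP; rewrite oner_eq0. Qed.

HB.instance Definition _ := GRing.Zmodule_isComNzRing.Build D
  dual_mulA dual_mulC dual_mul1 dual_mulD dual_one_neq0.

Fact dual_mulV : {in dual_unit, left_inverse 1 dual_inv *%R}.
Proof.
move=> [a b] au; have ua : a \is a GRing.unit := au.
rewrite /dual_inv ifT //; congr pair => /=; first by rewrite mulVr.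
by rewrite mulNr -!mulrA [b * a]mulrC !mulrA mulrVK // subrr.
Qed.
Fact dual_unitP (x y : D) : y * x = 1 -> dual_unit x.
Proof. 
move=> /(congr1 fst) /= h; apply/unitrP; exists y.1.
by split; last rewrite mulrC.
 Qed.
Fact dual_inv_out : {in [predC dual_unit], dual_inv =1 id}.
Proof. by move=> x /negPf xu; rewrite /dual_inv ifF. Qed.

HB.instance Definition _ := GRing.ComNzRing_hasMulInverse.Build D
  dual_mulV dual_unitP dual_inv_out.

End DualNumbers.

HB.instance Definition _ (A : topComUnitRingType) :=
  Topological.copy (dualnum A) (A * A)%type.

Section PGL2.
Variable A : comUnitRingType.

Definition GL2 := {g : 'M[A]_2 | g \in unitmx}.
HB.instance Definition _ := SubChoice.on GL2.

Definition GL2_one : GL2 := exist _ 1%:M (unitmx1 _ _).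

Definition scalar_equiv (g h : GL2) : bool :=
  `[< exists2 a : A, a \is a GRing.unit & \val g = a *: \val h >].

Lemma scalar_equiv_is_equiv : equiv_class_of scalar_equiv.
Proof.
split=> [g|g h|h g k].
- by apply/asboolP; exists 1; rewrite ?unitr1 ?scale1r.
- apply/asbool_equiv_eq; split=> -[a au ->]; exists a^-1;
  by rewrite ?unitrV// scalerA mulVr// scale1r.
- move=> /asboolP[a au ag] /asboolP[b bu bk]; apply/asboolP.
  by exists (a * b); rewrite ?unitrM ?au// ag bk scalerA.
Qed.

Canonical scalar_equiv_equiv := EquivRelPack scalar_equiv_is_equiv.
Canonical scalar_equiv_encModRel := defaultEncModRel scalar_equiv.

Definition PGL2 := {eq_quot scalar_equiv}.
HB.instance Definition _ : EqQuotient GL2 scalar_equiv PGL2 :=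
  EqQuotient.on PGL2.
HB.instance Definition _ := Choice.on PGL2.

(* The class of M; a junk value when M is not invertible. *)
Definition pgl (M : 'M[A]_2) : PGL2 := \pi_PGL2 (insubd GL2_one M).
Definition mx_of (g : PGL2) : 'M[A]_2 := \val (repr g).

Lemma mx_of_unit (g : PGL2) : mx_of g \in unitmx.
Proof. exact: (valP (repr g)). Qed.

Lemma mx_ofK : cancel mx_of pgl.
Proof. by move=> g; rewrite /pgl /mx_of valKd reprK. Qed.

Lemma pgl_eqP (M N : 'M[A]_2) : M \in unitmx -> N \in unitmx ->
  (pgl M = pgl N) <-> (exists2 a : A, a \is a GRing.unit & M = a *: N).
Proof.
move=> Mu Nu; split=> [/eqP|h]; last apply/eqP; rewrite /pgl piE.
  by move=> /asboolP; rewrite !insubdK.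
by apply/asboolP; rewrite !insubdK.
Qed.

Lemma mx_of_pgl (M : 'M[A]_2) : M \in unitmx ->
  exists2 a : A, a \is a GRing.unit & mx_of (pgl M) = a *: M.
Proof. by move=> Mu; apply/pgl_eqP; rewrite ?mx_of_unit// mx_ofK. Qed.

Definition pgl_mul (g h : PGL2) : PGL2 := pgl (mx_of g *m mx_of h).
Definition pgl_inv (g : PGL2) : PGL2 := pgl (invmx (mx_of g)).
Definition pgl_one : PGL2 := pgl 1%:M.

Lemma pglM (M N : 'M[A]_2) : M \in unitmx -> N \in unitmx ->
  pgl_mul (pgl M) (pgl N) = pgl (M *m N).
Proof.
move=> Mu Nu; have [a au aM] := mx_of_pgl Mu; have [b bu bN] := mx_of_pgl Nu.
apply/pgl_eqP; rewrite ?unitmx_mul ?mx_of_unit ?Mu//.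
exists (a * b); first by rewrite unitrM au.
by rewrite aM bN -scalemxAl -scalemxAr scalerA.
Qed.

Fact pgl_mulA : associative pgl_mul.
Proof.
move=> g h k; rewrite -[g]mx_ofK -[h]mx_ofK -[k]mx_ofK.
by rewrite !pglM ?unitmx_mul ?mx_of_unit// mulmxA.
Qed.
Fact pgl_mul1g : left_id pgl_one pgl_mul.
Proof.
by move=> g; rewrite -[g]mx_ofK pglM ?unitmx1 ?mx_of_unit// mul1mx.
Qed.
Fact pgl_mulg1 : right_id pgl_one pgl_mul.
Proof.
by move=> g; rewrite -[g]mx_ofK pglM ?unitmx1 ?mx_of_unit// mulmx1.
Qed.
Fact pgl_mulVg : left_inverse pgl_one pgl_inv pgl_mul.
Proof.
move=> g; rewrite -[X in pgl_mul _ X]mx_ofK pglM ?unitmx_inv ?mx_of_unit//.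
by rewrite mulVmx ?mx_of_unit.
Qed.
Fact pgl_mulgV : right_inverse pgl_one pgl_inv pgl_mul.
Proof.
move=> g; rewrite -[X in pgl_mul X _]mx_ofK pglM ?unitmx_inv ?mx_of_unit//.
by rewrite mulmxV ?mx_of_unit.
Qed.

HB.instance Definition _ := isGroup.Build PGL2
  pgl_mulA pgl_mul1g pgl_mulg1 pgl_mulVg pgl_mulgV.

End PGL2.

(* GL_2 has the subspace topology of the 2 x 2 matrices: for a local field and
   for its dualnum numbers this makes inversion continuous. *)
HB.instance Definition _ (A : topComUnitRingType) :=
  Topological.copy (GL2 A) (initial_topology (fun g : GL2 A => \val g)).

Section PGL2Topology.
Variable A : topComUnitRingType.

Definition pgl_open (U : set (PGL2 A)) : Prop :=
  open ((fun g : GL2 A => \pi_(PGL2 A) g) @^-1` U).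

Fact pgl_openT : pgl_open setT.
Proof. by rewrite /pgl_open preimage_setT; exact: openT. Qed.
Fact pgl_openI : setI_closed pgl_open.
Proof. by move=> U V oU oV; exact: openI. Qed.
Fact pgl_open_bigU (I : Type) (f : I -> set (PGL2 A)) :
  (forall i, pgl_open (f i)) -> pgl_open (\bigcup_i f i).
Proof. by move=> of_; apply: bigcup_open => i _; exact: of_. Qed.

HB.instance Definition _ :=
  isOpenTopological.Build (PGL2 A) pgl_openT pgl_openI pgl_open_bigU.

End PGL2Topology.

Section Groups.
Variable F : localFieldType.
Local Notation G := (PGL2 F).
Local Notation Geps := (PGL2 (dualnum F)).
Local Open Scope group_scope.

Definition embed (g : G) : Geps :=
  pgl (map_mx (fun a : F => (a, 0%R) : dualnum F) (mx_of g)).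

Definition one_plus_eps (m : 'M[F]_2) : Geps :=
  pgl (1%:M + map_mx (fun a : F => (0%R, a) : dualnum F) m)%R.

Definition dual_integral : pred (dualnum F) :=
  fun a => (0 <= valuation a.1)%E && (0 <= valuation a.2)%E.

(* The image of GL_2(O_eps) in PGL_2(F_eps); its intersection with the scalars
   consists of the units of O_eps, so this is PGL_2(O_eps). *)
Definition Keps : set Geps :=
  [set g | exists M : 'M[dualnum F]_2, [/\ M \in unitmx,
    M \is a mxOver dual_integral, invmx M \is a mxOver dual_integral
    & g = pgl M]].

Definition Ad (g : G) (m : 'M[F]_2) : 'M[F]_2 :=
  mx_of g *m m *m invmx (mx_of g).

Definition stabilizer (m : 'M[F]_2) : set G := [set g | Ad g m = m].

(* repr x is a lift of x to the valuation ring. *)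
Definition hecke_elt (p : F) (x : residue_field F) : Geps :=
  pgl (diag_mx (\row_(i < 2)
    if i == ord0 then (p, \val (repr x)) : dualnum F else 1%R)).

Definition double_coset (K : set Geps) (g : Geps) : set Geps :=
  [set k1 * g * k2 | k1 in K & k2 in K].

Definition left_cosets_in (K D : set Geps) : set (set Geps) :=
  [set c | c `<=` D /\ exists g, c = [set g * k | k in K]].

End Groups.

Section Representations.
Variables (R : realType) (F : localFieldType).
Local Notation C := (R[i]).
Local Notation G := (PGL2 F).
Local Notation Geps := (PGL2 (dualnum F)).

Definition additive_character (psi : F -> C) : Prop :=
  [/\ forall x y, psi (x + y) = psi x * psi y,
     forall x, `|psi x| = 1 & continuous (psi : F -> C^o)].

Definition conductor_integral (psi : F -> C) : Prop :=
  forall x : F, (forall y : F, (0 <= valuation y)%E -> psi (x * y) = 1) <->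
    (0 <= valuation x)%E.

Definition psi_mx (psi0 : F -> C) (m m' : 'M[F]_2) : C := psi0 (\tr (m *m m')).

Section RepOfSubgroup.
Variables (Z : set G) (W : lmodType C) (rho : G -> W -> W).

(* A representation of the subgroup Z of G: rho is relevant on Z only. *)
Definition is_rep : Prop :=
  [/\ forall z, Z z -> forall (a : C) (u w : W),
         rho z (a *: u + w) = a *: rho z u + rho z w,
      forall w, rho 1%g w = w
    & forall z z', Z z -> Z z' -> forall w, rho (z * z')%g w = rho z (rho z' w)].

Definition smooth_rep : Prop :=
  forall w : W, \forall z \near (1%g : G), Z z -> rho z w = w.

Definition irreducible_rep : Prop :=
  (exists w : W, w != 0) /\
  forall U : set W, U 0 -> (forall (a : C) u w, U u -> U w -> U (a *: u + w)) ->
    (forall z w, Z z -> U w -> U (rho z w)) -> U = [set 0] \/ U = setT.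

End RepOfSubgroup.

Section InducedSpace.
Variables (psi0 : F -> C) (m : 'M[F]_2) (W : lmodType C) (rho : G -> W -> W).
Local Notation Z := (stabilizer m).

Definition smooth_fun (f : Geps -> W) : Prop :=
  forall g, \forall h \near g, f h = f g.

(* The image of S in the quotient by left translations under Z is relatively
   compact. For S the support of a smooth function this image is closed, so it
   is then compact. *)
Definition compact_mod_left (Z S : set G) : Prop :=
  exists2 C : set G, compact C & S `<=` [set (z * c)%g | z in Z & c in C].

Definition Vspace : set (Geps -> W) :=
  [set f | [/\ smooth_fun f,
    forall m' g, \tr m' = 0 ->
      f (one_plus_eps m' * embed g)%g = psi_mx psi0 m m' *: f (embed g),
    forall z g, Z z -> f (embed (z * g)%g) = rho z (f (embed g))
    & compact_mod_left Z [set g | f (embed g) != 0]]].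

Definition rtrans (h : Geps) (f : Geps -> W) : Geps -> W :=
  fun g => f (g * h)%g.

Definition Vfixed : set (Geps -> W) :=
  [set f | Vspace f /\ forall k, @Keps F k -> rtrans k f = f].

(* The sum runs over the finitely many left cosets of Keps in the double coset;
   on Keps-fixed functions the choice of an element of each coset is immaterial. *)
Definition hecke (p : F) (x : residue_field F) (f : Geps -> W) : Geps -> W :=
  fun g => (residue_card F)%:R^-1 *:
    \sum_(c \in left_cosets_in (@Keps F)
                   (double_coset (@Keps F) (hecke_elt p x)))
      rtrans (xget 1%g c) f g.

End InducedSpace.
End Representations.

(* Main.v *)
(* Put K = K_eps and t = p + eps x. The left cosets of K in K g_x K are
   represented by w^i [[t, b + eps c], [0, 1]] with w the Weyl element, b and c
   running over residue classes, and b = 0 if i = 1. Such a representative is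
   h (1 + eps n) with h = w^i [[p, b], [0, 1]] and n = [[x/p, c/p], [0, 0]], so for
   fixed i and b only the sum over c involves x. By equivariance
   f(gh(1 + eps n)) = psi0(tr(m' n)) f(gh) for a conjugate m' of m, and m' is
   integral when f(gh) <> 0, since f is fixed by 1 + eps M_2(O). With a and r the
   (0,0) and (1,0) entries of m', tr(m' n) = (a x + r c)/p. If r is a unit, the sum
   over c vanishes; otherwise a^2 = - det m - r m'_01 lies in the maximal ideal,
   hence so does a, and psi0(a x/p) = 1. *)
Require Import Defs.
From HB Require Import structures.
From mathcomp Require Import all_boot all_order all_algebra ring_quotient.
From mathcomp Require Import all_classical all_reals all_analysis.
From mathcomp Require Import complex ring.
Set Implicit Arguments.
Unset Strict Implicit.
Unset Printing Implicit Defensive.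
Import Order.TTheory GRing.Theory Num.Theory.
Local Open Scope classical_set_scope.
Local Open Scope ring_scope.

(** * The maximal ideal of the valuation ring *)

Section Valuation.
Variable F : localFieldType.
Implicit Types x y : F.
Local Notation v := (@valuation F).
Local Notation O := (@valring_pred F).

(** The ideal [maxideal] of [valring], as a predicate on [F] itself so that arithmetic takes place
    in the field. *)
Definition maxid : pred F := fun x => (1%:E <= v x)%E.

Lemma valringE x : (x \in O) = (0 <= v x)%E. Proof. by []. Qed.

Lemma maxidW x : maxid x -> x \in O.
Proof. by rewrite valringE; apply: le_trans; rewrite lee_fin. Qed.

Lemma maxidB x y : maxid x -> maxid y -> maxid (x - y).
Proof. exact: valuationB. Qed.

Lemma maxid0 : maxid 0.
Proof. by rewrite /maxid valuation0 leey. Qed.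

Lemma maxidN x : maxid (- x) = maxid x.
Proof. by rewrite /maxid valuationN. Qed.

Lemma maxidD x y : maxid x -> maxid y -> maxid (x + y).
Proof. by move=> mx my; rewrite -[y]opprK; apply: maxidB; rewrite ?maxidN. Qed.

Lemma maxidMl x y : x \in O -> maxid y -> maxid (x * y).
Proof.
rewrite valringE /maxid valuationM => xO yO.
by rewrite -[X in (X <= _)%E]add0e; apply: leeD.
Qed.

Lemma maxidMr x y : maxid x -> y \in O -> maxid (x * y).
Proof. by move=> mx yO; rewrite mulrC; exact: maxidMl. Qed.

Lemma maxid1 : maxid 1 = false.
Proof. by rewrite /maxid valuation1 lee_fin. Qed.

(** The valuation of [x] is an integer in [0, 1), hence 0, and additivity of the valuation gives 0
    for the inverse too. *)
Lemma unit_valring x : x \in O -> ~~ maxid x -> x != 0 /\ x^-1 \in O.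
Proof.
move=> xO mx; have x0 : x != 0 by apply: contraNneq mx => ->; exact: maxid0.
split=> //; have := valuationM x x^-1.
rewrite divff // valuation1; move: xO mx; rewrite !valringE /maxid.
case: (v x) => [r||] //; case: (v x^-1) => [s||] //.
rewrite !lee_fin => r0; rewrite -ltNge => r1 [].
have -> : r = 0 by apply/eqP; rewrite eq_le r0 andbT -ltzD1.
by rewrite add0r => <-.
Qed.

Lemma maxid_prime x y : x \in O -> y \in O -> maxid (x * y) -> maxid x \/ maxid y.
Proof.
move=> xO yO mxy; case: (boolP (maxid x)) => [|/(unit_valring xO)[x0 xV]]; first by left.
by right; rewrite -(mulKf x0 y); exact: maxidMl.
Qed.

Variable p : F.
Hypothesis p_unif : uniformizer p.

Lemma uniformizer_neq0 : p != 0.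
Proof.
have [x x1] := valuation_normalized (s := F).
have [|y _ xE] := (p_unif x).1; first by rewrite x1.
apply: contra_eq_neq x1 => p0; rewrite xE p0 mul0r valuation0 //.
Qed.

Lemma maxid_uniformizer : maxid p.
Proof. by apply/p_unif; exists 1; rewrite ?mulr1 ?valuation1. Qed.

Lemma maxid_div x : maxid x -> x / p \in O.
Proof. by move=> /p_unif[y yO ->]; rewrite mulrC mulKf ?uniformizer_neq0. Qed.

Lemma maxid_mulp x : x \in O -> maxid (p * x).
Proof. by move=> xO; apply: maxidMr => //; exact: maxid_uniformizer. Qed.

End Valuation.

(** * Lifts of residue classes, finiteness of the residue field *)

Section ResidueLift.
Variable F : localFieldType.
Local Notation O := (@valring_pred F).
Local Notation kappa := (residue_field F).

(** A set-theoretic section of reduction: it respects sums only modulo the maximal ideal. *)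
Definition res_lift (b : kappa) : F := \val (repr b).

Definition res_class (x : F) : kappa :=
  (\pi_kappa (insubd (0 : valring F) x))%qT.

Lemma res_lift_valring b : res_lift b \in O.
Proof. exact: valP (repr b). Qed.

Lemma res_lift_class x : x \in O -> maxid (x - res_lift (res_class x)).
Proof.
move=> xO; have : insubd (0 : valring F) x - repr (res_class x)
  \in (@maxideal F : idealr (valring F)).
  by rewrite Quotient.idealrBE reprK.
by rewrite -topredE /= /maxideal rmorphB /= insubdK.
Qed.

Lemma res_lift_inj b c : maxid (res_lift b - res_lift c) -> b = c.
Proof.
move=> bc; have : repr b - repr c \in (@maxideal F : idealr (valring F)).
  by rewrite -topredE /= /maxideal rmorphB.
by rewrite Quotient.idealrBE !reprK => /eqP.
Qed.

Lemma res_lift0 : maxid (res_lift 0).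
Proof.
have : repr (0 : kappa) - 0 \in (@maxideal F : idealr (valring F)).
  by rewrite Quotient.idealrBE reprK -[X in _ == X]/(\pi_kappa 0)%qT rmorph0.
by rewrite subr0.
Qed.

Lemma res_liftD b c : maxid (res_lift (b + c) - (res_lift b + res_lift c)).
Proof.
have : repr (b + c) - (repr b + repr c) \in (@maxideal F : idealr (valring F)).
  by rewrite Quotient.idealrBE rmorphD /= !reprK.
by rewrite -topredE /= /maxideal rmorphB rmorphD.
Qed.

Lemma finite_residue_field : finite_set [set: kappa].
Proof.
have [s sP] := residue_finite (s := F).
apply: (@sub_finite_set _ _ (res_class @` [set` s])); last first.
  by apply: finite_image; exact: finite_seq.
move=> b _; have [y ys yb] := sP _ (res_lift_valring b).
exists y => //; apply: res_lift_inj.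
(* The finite list may contain non-integral elements; this [y] is integral because it is congruent
   to an integral lift. *)
have yO : y \in O.
  rewrite -[y](subKr (res_lift b)); apply: rpredB; first exact: res_lift_valring.
  exact: maxidW.
have -> : res_lift (res_class y) - res_lift b =
  - (y - res_lift (res_class y)) - (res_lift b - y) by ring.
by apply: maxidB; rewrite ?maxidN; [exact: res_lift_class | exact: yb].
Qed.

End ResidueLift.

(** * Sums of an additive character over residue classes *)

Section CharacterSum.
Variables (R : realType) (F : localFieldType) (psi : F -> R[i]).
Hypothesis psi_char : additive_character psi.
Local Notation O := (@valring_pred F).

Lemma additive_characterD x y : psi (x + y) = psi x * psi y.
Proof. by case: psi_char. Qed.

Lemma additive_character0 : psi 0 = 1.
Proof.
have n0 : psi 0 != 0 by case: psi_char => _ n1 _; rewrite -normr_eq0 n1 oner_eq0.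
by apply: (mulfI n0); rewrite -additive_characterD addr0 mulr1.
Qed.

(** Translation by the class of [y] permutes the summands and multiplies the sum by psi(e y), which
    is not 1. Triviality on the maximal ideal makes the choice of lifts immaterial. *)
Lemma character_sum_eq0 (e : F) :
  (forall y, maxid y -> psi (e * y) = 1) -> (exists2 y, y \in O & psi (e * y) != 1) ->
  \sum_(b \in [set: residue_field F]) psi (e * res_lift b) = 0.
Proof.
move=> triv [y yO ny]; set S := LHS.
have shift (x z : F) : maxid (x - z) -> psi (e * x) = psi (e * z).
  by move=> /triv xz; rewrite -[x](subrK z) mulrDr additive_characterD xz mul1r.
have SE : S = psi (e * y) * S.
  rewrite {1}/S (reindex_fsbigT (fun b : residue_field F => res_class y + b)); last first.
    by exists (fun b => - res_class y + b) => b; rewrite addrA ?addNr ?subrr add0r.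
  rewrite mulr_fsumr; apply: eq_fsbigr => b _.
  rewrite -additive_characterD -mulrDr; apply: shift.
  have -> : res_lift (res_class y + b) - (y + res_lift b) =
    res_lift (res_class y + b) - (res_lift (res_class y) + res_lift b)
    - (y - res_lift (res_class y)) by ring.
  by apply: maxidB; [exact: res_liftD | exact: res_lift_class].
apply/eqP; have : (1 - psi (e * y)) * S = 0 by rewrite mulrBl mul1r -SE subrr.
by move/eqP; rewrite mulf_eq0 subr_eq0 eq_sym (negPf ny).
Qed.

End CharacterSum.

(** * Left cosets and two-by-two matrices *)

Lemma left_coset_eqP (G : groupType) (K : set G) :
  K 1%g -> (forall k l, K k -> K l -> K (k * l)%g) -> (forall k, K k -> K (k^-1)%g) ->
  forall g h, [set (g * k)%g | k in K] = [set (h * k)%g | k in K] <->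
    exists2 k, K k & g = (h * k)%g.
Proof.
move=> K1 KM KV g h; split=> [gh|[k Kk ->]].
  have : [set (g * k)%g | k in K] g by exists 1%g => //; rewrite mulg1.
  by rewrite gh => -[k Kk <-]; exists k.
apply/seteqP; split=> _ [l Kl <-].
  by exists (k * l)%g; [exact: KM | rewrite mulgA].
exists (k^-1 * l)%g; first by apply: KM => //; exact: KV.
by rewrite mulgA mulgK.
Qed.

Section TwoByTwo.
Variable A : comUnitRingType.
Implicit Types a b c d : A.

Definition mx2 a b c d : 'M[A]_2 :=
  \matrix_(i, j) if i == 0 then (if j == 0 then a else b) else (if j == 0 then c else d).

Lemma mx2E a b c d : (mx2 a b c d 0 0 = a) * (mx2 a b c d 0 1 = b)
  * (mx2 a b c d 1 0 = c) * (mx2 a b c d 1 1 = d).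
Proof. by rewrite !mxE. Qed.

Lemma ord2P (P : 'I_2 -> Prop) : P 0 -> P 1 -> forall i, P i.
Proof.
move=> P0 P1 [[|[|//]] i2].
  by rewrite (_ : Ordinal i2 = 0) //; apply: val_inj.
by rewrite (_ : Ordinal i2 = 1) //; apply: val_inj.
Qed.

Lemma mx2P (M N : 'M[A]_2) :
  M 0 0 = N 0 0 -> M 0 1 = N 0 1 -> M 1 0 = N 1 0 -> M 1 1 = N 1 1 -> M = N.
Proof. by move=> *; apply/matrixP; apply: ord2P; apply: ord2P. Qed.

Lemma mx2_eta (M : 'M[A]_2) : M = mx2 (M 0 0) (M 0 1) (M 1 0) (M 1 1).
Proof. by apply: mx2P; rewrite mx2E. Qed.

Lemma mulmx2E (M N : 'M[A]_2) i j : (M *m N) i j = M i 0 * N 0 j + M i 1 * N 1 j.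
Proof.
rewrite mxE big_ord_recl big_ord1; congr (_ + M _ _ * N _ _); exact: val_inj.
Qed.

Lemma mx2M a b c d a' b' c' d' : mx2 a b c d *m mx2 a' b' c' d' =
  mx2 (a * a' + b * c') (a * b' + b * d') (c * a' + d * c') (c * b' + d * d').
Proof. by apply: mx2P; rewrite mulmx2E !mx2E. Qed.

Lemma det_mx2 a b c d : \det (mx2 a b c d) = a * d - b * c.
Proof.
rewrite (expand_det_row _ 0) big_ord_recl big_ord1 /cofactor !det_mx11 !mxE /=.
by rewrite expr0 mul1r expr1 mulN1r mulrN.
Qed.

Lemma mxtrace2 (M : 'M[A]_2) : \tr M = M 0 0 + M 1 1.
Proof. by rewrite /mxtrace big_ord_recl big_ord1; congr (_ + M _ _); exact: val_inj. Qed.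

Lemma mx2_1 : 1%:M = mx2 1 0 0 1.
Proof. by apply: mx2P; rewrite !mxE. Qed.

End TwoByTwo.

Lemma invmx_uniq (A : comUnitRingType) n (M N : 'M[A]_n) : M *m N = 1%:M -> invmx M = N.
Proof.
by move=> MN; rewrite -[LHS]mulmx1 -MN mulmxA mulVmx ?mul1mx //; case/mulmx1_unit: MN.
Qed.

Lemma mul_pgl (A : comUnitRingType) (M N : 'M[A]_2) : M \in unitmx -> N \in unitmx ->
  (pgl M * pgl N)%g = pgl (M *m N).
Proof. exact: pglM. Qed.

Lemma pglV (A : comUnitRingType) (M : 'M[A]_2) : M \in unitmx -> ((pgl M)^-1)%g = pgl (invmx M).
Proof.
move=> Mu; have VM : (pgl (invmx M) * pgl M)%g = 1%g.
  by rewrite [LHS]pglM ?unitmx_inv // mulVmx.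
by rewrite -[RHS]mulg1 -(mulgV (pgl M)) mulgA VM mul1g.
Qed.

(** * Integral dual numbers and the group [Keps] *)

Section DualIntegral.
Variable F : localFieldType.
Local Notation D := (dualnum F).
Local Notation O := (@valring_pred F).
Local Notation OD := (@dual_integral F).

Lemma dual_mul_fst (x y : D) : (x * y).1 = x.1 * y.1. Proof. by []. Qed.
Lemma dual_mul_snd (x y : D) : (x * y).2 = x.1 * y.2 + x.2 * y.1. Proof. by []. Qed.

Lemma dual_unitE (x : D) : (x \is a GRing.unit) = (x.1 != 0).
Proof. by rewrite -unitfE. Qed.

Lemma dual_integralE (x : D) : (x \in OD) = (x.1 \in O) && (x.2 \in O).
Proof. by []. Qed.

Lemma dual_integral_subring : subring_closed OD.
Proof.
split=> [|x y|x y]; rewrite !dual_integralE.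
- by rewrite rpred1 rpred0.
- by move=> /andP[? ?] /andP[? ?]; rewrite !rpredB.
- move=> /andP[? ?] /andP[? ?]; rewrite dual_mul_fst dual_mul_snd.
  by rewrite rpredM // rpredD // rpredM.
Qed.

HB.instance Definition _ :=
  GRing.isSubringClosed.Build D (@dual_integral F) dual_integral_subring.

Lemma dual_integralV (x : D) : x \in OD -> ~~ maxid x.1 -> x^-1 \in OD.
Proof.
rewrite dual_integralE => /andP[x1 x2] /(unit_valring x1)[x0 xV].
have xu : dual_unit x by rewrite /dual_unit unitfE.
have -> : x^-1 = (x.1^-1, - (x.1^-1 * x.1^-1 * x.2)) :> D.
  by rewrite -[x^-1]/(dual_inv x) /dual_inv xu.
by rewrite dual_integralE /= xV rpredN !rpredM.
Qed.

Lemma det_integral n (M : 'M[D]_n) : M \is a mxOver OD -> \det M \in OD.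
Proof.
move=> /mxOverP MO; apply: rpred_sum => s _; apply: rpredM; first exact: rpred_sign.
by apply: rpred_prod.
Qed.

Lemma mxOver_mx2 (a b c d : D) : a \in OD -> b \in OD -> c \in OD -> d \in OD ->
  mx2 a b c d \is a mxOver OD.
Proof. by move=> *; apply/mxOverP; apply: ord2P; apply: ord2P; rewrite mx2E. Qed.

(** The inverse is the adjugate divided by the determinant, and an integral dual number has an
    integral inverse as soon as its first component is a unit of O. *)
Lemma Keps_pgl (M : 'M[D]_2) : M \is a mxOver OD -> ~~ maxid (\det M).1 ->
  Keps (pgl M).
Proof.
move=> MO dM; have dO := det_integral MO; have [d0 _] := unit_valring (proj1 (andP dO)) dM.
have Mu : M \in unitmx by rewrite unitmxE dual_unitE.
exists M; split => //; rewrite /invmx Mu; apply: mxOverZ; first exact: dual_integralV.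
apply/mxOverP => i j; rewrite mxE /cofactor rpredM ?rpred_sign //.
apply: det_integral; apply/mxOverP => k l; rewrite !mxE.
by move/mxOverP: MO.
Qed.

Lemma KepsM (g h : PGL2 D) : Keps g -> Keps h -> Keps (g * h)%g.
Proof.
move=> [M [Mu MO MV ->]] [N [Nu NO NV ->]]; exists (M *m N); split.
- by rewrite unitmx_mul Mu.
- exact: mxOverM.
- rewrite (@invmx_uniq _ _ _ (invmx N *m invmx M)); first exact: mxOverM.
  by rewrite mulmxA mulmxK // mulmxV.
- exact: pglM.
Qed.

Lemma KepsV (g : PGL2 D) : Keps g -> Keps (g^-1)%g.
Proof.
move=> [M [Mu MO MV ->]]; exists (invmx M).
by split; [rewrite unitmx_inv | exact: MV | rewrite invmxK | exact: pglV].
Qed.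

Lemma Keps1 : Keps (1%g : PGL2 D).
Proof.
exists 1%:M; rewrite unitmx1 invmx1.
have I1 : (1%:M : 'M[D]_2) \is a mxOver OD by apply: mxOver_scalar; rewrite ?rpred0 ?rpred1.
by split; [| | |].
Qed.

Lemma Keps_coset (g h : PGL2 D) :
  [set (g * k)%g | k in @Keps F] = [set (h * k)%g | k in @Keps F] <->
  exists2 k, Keps k & g = (h * k)%g.
Proof. exact: (left_coset_eqP Keps1 KepsM KepsV). Qed.

End DualIntegral.

(** * Matrices over the dual numbers, written A + eps B *)

Section DualMatrix.
Variable F : localFieldType.
Local Notation D := (dualnum F).
Implicit Types A B C E : 'M[F]_2.

Definition dmx A B : 'M[D]_2 := \matrix_(i, j) ((A i j, B i j) : D).

Lemma dmxM A B C E : dmx A B *m dmx C E = dmx (A *m C) (A *m E + B *m C).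
Proof.
apply/matrixP => i j; rewrite mulmx2E !mxE; congr pair => /=.
  by rewrite big_ord_recl big_ord1; congr (_ + A _ _ * C _ _); apply: val_inj.
rewrite addrACA; congr (_ + _); rewrite big_ord_recl big_ord1.
  by congr (_ + A _ _ * E _ _); apply: val_inj.
by congr (_ + B _ _ * C _ _); apply: val_inj.
Qed.

Lemma dmx1 : dmx 1%:M 0 = 1%:M.
Proof. by apply: mx2P; rewrite !mxE. Qed.

Lemma dmx_eta (M : 'M[D]_2) : M = dmx (map_mx fst M) (map_mx snd M).
Proof. by apply/matrixP => i j; rewrite !mxE; case: (M i j). Qed.

Lemma dmx_unit A B : (dmx A B \in unitmx) = (A \in unitmx).
Proof.
apply/idP/idP => [/mulmxV|Au].
  rewrite [invmx _]dmx_eta dmxM -dmx1 => /matrixP AC.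
  have /mulmx1_unit[] // : A *m map_mx fst (invmx (dmx A B)) = 1%:M.
  by apply/matrixP => i j; have /(congr1 fst) := AC i j; rewrite [dmx _ _ i j]mxE [in RHS]mxE.
(* The inverse of A + eps B is A^-1 - eps A^-1 B A^-1. *)
have AC : dmx A B *m dmx (invmx A) (- (invmx A *m B *m invmx A)) = 1%:M.
  by rewrite dmxM mulmxV // mulmxN -mulmxA mulKVmx // addNr dmx1.
by have [ABu _] := mulmx1_unit AC.
Qed.

Lemma one_plus_epsE A : one_plus_eps A = pgl (dmx 1%:M A).
Proof.
congr pgl; apply/matrixP => i j; rewrite !mxE.
by case: (i == j); congr pair; rewrite /= ?addr0 ?add0r.
Qed.

Lemma embed_pgl A : A \in unitmx -> embed (pgl A) = pgl (dmx A 0).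
Proof.
move=> Au; have [a au aE] := mx_of_pgl Au.
apply/pgl_eqP.
- rewrite (_ : map_mx _ _ = dmx (mx_of (pgl A)) 0) ?dmx_unit ?mx_of_unit //.
  by apply/matrixP => i j; rewrite !mxE.
- by rewrite dmx_unit.
exists ((a, 0) : D); first by rewrite dual_unitE /= -unitfE.
by apply/matrixP => i j; rewrite aE !mxE; congr pair; rewrite /= ?mulr0 ?mul0r ?addr0.
Qed.

Lemma pgl_dmxP (g : PGL2 D) : exists A B, A \in unitmx /\ g = pgl (dmx A B).
Proof.
exists (map_mx fst (mx_of g)), (map_mx snd (mx_of g)).
by rewrite -(dmx_unit _ (map_mx snd (mx_of g))) -dmx_eta mx_of_unit mx_ofK.
Qed.

End DualMatrix.

(** * Transformation of f under 1 + eps n *)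

Section Equivariance.
Variables (R : realType) (F : localFieldType).
Hypothesis charF : 2%N \notin [pchar F].
Variables (psi0 : F -> R[i]) (m : 'M[F]_2) (W : lmodType R[i]) (rho : PGL2 F -> W -> W).
Hypotheses (psi0_char : additive_character psi0) (m_sl2 : \tr m = 0).
Variable f : PGL2 (dualnum F) -> W.
Hypothesis fV : Vspace psi0 m rho f.
Local Notation D := (dualnum F).

(** Factor A + eps B as (1 + eps B A^-1) A. Equivariance is given for trace-zero matrices only, so a
    scalar is subtracted from B A^-1; it is invisible in PGL_2 and in the trace against [m]. *)
Lemma Vspace_dmx (A B : 'M[F]_2) : A \in unitmx ->
  f (pgl (dmx A B)) = psi0 (\tr (m *m (B *m invmx A))) *: f (pgl (dmx A 0)).
Proof.
move=> Au; have n2 : (2 : F) != 0.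
  by apply: contraNneq charF => n2; rewrite inE /= n2 eqxx.
(* Characteristic different from 2 allows halving the trace. *)
set n := B *m invmx A; pose s := \tr n / 2; pose m' := n - s%:M.
have m'0 : \tr m' = 0 by rewrite linearB /= mxtrace_scalar -mulr_natr divfK ?subrr.
have fE := fV; case: fE => _ fE _ _; have {fE} := fE m' (pgl A) m'0.
rewrite /psi_mx (_ : \tr (m *m m') = \tr (m *m n)); last first.
  by rewrite mulmxBr linearB /= mul_mx_scalar mxtraceZ m_sl2 mulr0 subr0.
rewrite (embed_pgl Au) => <-; apply: (congr1 f).
rewrite one_plus_epsE; have Iu : dmx 1%:M m' \in unitmx by rewrite dmx_unit unitmx1.
have A0u : dmx A 0 \in unitmx by rewrite dmx_unit.
rewrite (mul_pgl Iu A0u) dmxM mul1mx mulmx0 add0r.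
apply/pgl_eqP; rewrite ?dmx_unit //.
(* The scalar 1 + eps s restores what was subtracted: (1 + eps s)(A + eps m' A) = A + eps (m' + s)
   A. *)
exists ((1, s) : D); first by rewrite dual_unitE /= oner_eq0.
rewrite mulmxBl mulmxKV // mul_scalar_mx.
by apply/matrixP => i j; rewrite !mxE; congr pair; rewrite /= !mul1r // subrK.
Qed.

(* Right translation by 1 + eps n replaces m by its conjugate A^-1 m A, where A
   is the image of g in PGL_2(F). *)
Lemma Vspace_one_plus_eps (g : PGL2 D) : exists mg : 'M[F]_2,
  [/\ \tr mg = 0, \det mg = \det m &
   forall n, f (g * one_plus_eps n)%g = psi0 (\tr (mg *m n)) *: f g].
Proof.
have [A [B [Au ->]]] := pgl_dmxP g; exists (invmx A *m m *m A); split.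
- by rewrite mxtrace_mulC mulmxA mulmxV // mul1mx.
- by rewrite !det_mulmx det_inv mulrAC mulVr ?mul1r // -unitmxE.
move=> n; rewrite one_plus_epsE.
have Iu : dmx 1%:M n \in unitmx by rewrite dmx_unit unitmx1.
have ABu : dmx A B \in unitmx by rewrite dmx_unit.
rewrite (mul_pgl ABu Iu) dmxM !mulmx1; apply: (etrans (Vspace_dmx _ Au)).
apply: etrans (congr1 _ (esym (Vspace_dmx B Au))).
rewrite scalerA; congr (_ *: _).
rewrite -(additive_characterD psi0_char); congr psi0.
rewrite -linearD /= mulmxDl mulmxDr !linearD /=; congr (_ + _).
by rewrite -!mulmxA [RHS]mxtrace_mulC !mulmxA.
Qed.

End Equivariance.

(** * Summation over the eps-component c *)

Section InnerSum.
Variables (R : realType) (F : localFieldType).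
Hypothesis charF : 2%N \notin [pchar F].
Variables (p : F) (psi0 : F -> R[i]).
Variables (m : 'M[F]_2) (W : lmodType R[i]) (rho : PGL2 F -> W -> W).
Hypotheses (p_unif : uniformizer p) (psi0_char : additive_character psi0).
Hypotheses (psi0_cond : conductor_integral psi0) (m_sl2 : \tr m = 0).
Hypothesis det_m : (1%:E <= valuation (\det m))%E.
Variable f : PGL2 (dualnum F) -> W.
Hypothesis fV : Vfixed psi0 m rho f.
Local Notation D := (dualnum F).
Local Notation O := (@valring_pred F).

Lemma one_plus_eps_Keps (n : 'M[F]_2) : n \is a mxOver O -> Keps (one_plus_eps n).
Proof.
move=> /mxOverP nO; rewrite one_plus_epsE; apply: Keps_pgl.
  apply/mxOverP => i j; rewrite mxE dual_integralE /= nO andbT mxE.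
  by case: (i == j); rewrite ?rpred0 ?rpred1.
by rewrite [dmx _ _]mx2_eta det_mx2 !mxE /= mulr0 subr0 mulr1 maxid1.
Qed.

Lemma hecke_inner_sum (g : PGL2 D) (x : F) : x \in O ->
  \sum_(b \in [set: residue_field F])
    f (g * one_plus_eps (mx2 (x / p) (res_lift b / p) 0 0))%g =
  \sum_(b \in [set: residue_field F])
    f (g * one_plus_eps (mx2 0 (res_lift b / p) 0 0))%g.
Proof.
move=> xO; have [fVs fK] := fV.
have [mg [trmg detmg fg]] := Vspace_one_plus_eps charF psi0_char m_sl2 fVs g.
have trE (u w : F) : \tr (mg *m mx2 u w 0 0) = mg 0 0 * u + mg 1 0 * w.
  by rewrite mxtrace2 !mulmx2E !mx2E !mulr0 !addr0.
have sumE (z : F) : \sum_(b \in [set: residue_field F])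
    f (g * one_plus_eps (mx2 z (res_lift b / p) 0 0))%g =
  \sum_(b \in [set: residue_field F])
    (psi0 (mg 0 0 * z) * psi0 (mg 1 0 * (res_lift b / p))) *: f g.
  by apply: eq_fsbigr => b _; rewrite fg trE (additive_characterD psi0_char).
apply: (etrans (sumE _)); apply: (etrans _ (esym (sumE _))).
rewrite mulr0 (additive_character0 psi0_char).
have [fg0|fg0] := eqVneq (f g) 0.
  by apply: eq_fsbigr => b _; rewrite fg0 !scaler0.
(* Invariance under 1 + eps y E_ji, with [f g] nonzero, gives psi0(y mg_ij) = 1 for all integral y;
   the conductor then makes mg_ij integral. *)
have mgO : mg \is a mxOver O.
  apply/mxOverP => i j; apply/psi0_cond => y yO.
  have nO : y *: delta_mx j i \is a mxOver O.
    apply/mxOverP => k l; rewrite !mxE; apply: rpredM => //.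
    by case: (_ && _); rewrite ?rpred0 ?rpred1.
  have /(congr1 (fun h => h g)) := fK _ (one_plus_eps_Keps nO).
  rewrite /rtrans fg -scalemxAr mxtraceZ.
  have -> : \tr (mg *m delta_mx j i) = mg i j.
    rewrite mxtrace_mulC /mxtrace (bigD1 j) //= big1 ?addr0 => [|k kj].
      rewrite mxE (bigD1 i) //= big1 ?addr0 ?mxE ?eqxx ?mul1r // => l li.
      by rewrite mxE (negPf li) andbF mul0r.
    by rewrite mxE big1 // => l _; rewrite mxE (negPf kj) mul0r.
  move=> /eqP; rewrite -subr_eq0 -[X in _ - X]scale1r -scalerBl scaler_eq0 (negPf fg0) orbF.
  by rewrite subr_eq0 mulrC => /eqP.
move/mxOverP: mgO => mgO.
have [mg10|mg10] := boolP (maxid (mg 1 0)).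
  have mg00 : maxid (mg 0 0).
    have : maxid (mg 0 0 * mg 0 0).
      have -> : mg 0 0 * mg 0 0 = - (\det m + mg 0 1 * mg 1 0).
        have mg11 : mg 1 1 = - mg 0 0 by apply/eqP; rewrite -addr_eq0 addrC -mxtrace2 trmg.
        by rewrite -detmg [mg]mx2_eta det_mx2 !mx2E mg11; ring.
      by rewrite maxidN; apply: maxidD; [exact: det_m | exact: maxidMl].
    by move=> /(maxid_prime (mgO 0 0) (mgO 0 0)) [].
  apply: eq_fsbigr => b _; rewrite (_ : psi0 (mg 0 0 * (x / p)) = 1) ?mul1r //.
  rewrite mulrCA.
  exact: ((psi0_cond x).2 xO _ (maxid_div p_unif mg00)).
(* Take e = mg_10 / p. The character is trivial on the maximal ideal because mg_10 is integral; were
   it trivial on O as well, e would be integral and mg_10 would lie in the maximal ideal. *)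
have S0 : \sum_(b \in [set: residue_field F]) psi0 (mg 1 0 * (res_lift b / p)) = 0.
  under eq_fsbigr do rewrite mulrCA mulrC.
  apply: character_sum_eq0 => //.
    move=> y my; rewrite mulrAC -mulrA.
    exact: ((psi0_cond (mg 1 0)).2 (mgO 1 0) _ (maxid_div p_unif my)).
  apply: contrapT => triv.
  have : mg 1 0 / p \in O.
    apply/psi0_cond => y yO; apply: contrapT => /eqP ny; apply: triv.
    by exists y.
  by move=> /(maxid_mulp p_unif); rewrite mulrC divfK ?(uniformizer_neq0 p_unif) // (negPf mg10).
have fin := finite_residue_field F.
have sum0 (c : R[i]) : \sum_(b \in [set: residue_field F])
    (c * psi0 (mg 1 0 * (res_lift b / p))) *: f g = 0.
  by rewrite fsbig_finite //= -scaler_suml -(fsbig_finite _ _ fin) -mulr_fsumr S0 mulr0 scale0r.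
by rewrite !sum0.
Qed.
End InnerSum.

(** * Representatives of the left cosets in the Hecke double coset *)

Section Cosets.
Variables (F : localFieldType) (p : F).
Hypothesis p_unif : uniformizer p.
Local Notation D := (dualnum F).
Local Notation O := (@valring_pred F).
Local Notation OD := (@dual_integral F).
Local Notation kappa := (residue_field F).

Definition hecke_entry (x : F) : D := (p, x).

(** The remainders of division by [hecke_entry x]. *)
Definition dual_lift (b c : kappa) : D := (res_lift b, res_lift c).

(* When i holds the lower right entry of the matrix of K_eps being multiplied is
   in the maximal ideal, so the residue class b is 0. *)
Definition coset_index : set (bool * kappa) := [set ib : bool * kappa | is_true ib.1 -> ib.2 = 0].

Definition coset_rep (x : F) (i : bool) (b c : kappa) : 'M[D]_2 :=
  if i then mx2 0 1 (hecke_entry x) (dual_lift b c) else mx2 (hecke_entry x) (dual_lift b c) 0 1.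

Lemma dual_lift_integral b c : dual_lift b c \in OD.
Proof. by rewrite dual_integralE /= !res_lift_valring. Qed.

Lemma coset_rep_unit x i b c : coset_rep x i b c \in unitmx.
Proof.
have p0 := uniformizer_neq0 p_unif.
rewrite unitmxE dual_unitE /coset_rep; case: i; rewrite det_mx2 /=.
  by rewrite mul0r mul1r sub0r oppr_eq0.
by rewrite mulr0 mulr1 subr0.
Qed.

(** Both x and c sit in the row of p, so dividing them by p moves them into a right factor, where
    equivariance applies. *)
Lemma coset_rep_one_plus_eps x i b c : pgl (coset_rep x i b c) =
  (pgl (dmx (if i then mx2 0 1 p (res_lift b) else mx2 p (res_lift b) 0 1) 0) *
   one_plus_eps (mx2 (x / p) (res_lift c / p) 0 0))%g.
Proof.
have p0 := uniformizer_neq0 p_unif.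
rewrite one_plus_epsE mul_pgl ?dmx_unit ?unitmx1 //; last first.
  rewrite unitmxE unitfE; case: i; rewrite det_mx2.
    by rewrite mul0r mul1r sub0r oppr_eq0.
  by rewrite mulr0 mulr1 subr0.
apply: (congr1 (@pgl _)); rewrite dmxM mulmx1 mul0mx addr0 /coset_rep; case: i.
  rewrite mx2M; apply: mx2P; rewrite !mxE /=; congr pair;
    by rewrite ?mul0r ?mul1r ?mulr0 ?add0r ?addr0 // mulrCA divff // mulr1.
rewrite mx2M; apply: mx2P; rewrite !mxE /=; congr pair;
  by rewrite ?mul0r ?mul1r ?mulr0 ?add0r ?addr0 // mulrCA divff // mulr1.
Qed.

Lemma hecke_eltE (x : kappa) : hecke_elt p x = pgl (mx2 (hecke_entry (res_lift x)) 0 0 1).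
Proof. by apply: (congr1 (@pgl _)); apply: mx2P; rewrite !mxE. Qed.

(** Division with remainder by t = p + eps x, one component at a time: the first quotient z1
    contributes x z1 to the second component, so y.2 - x z1 is what gets divided next. *)
Lemma dual_divmod x (y : D) : x \in O -> y \in OD -> exists b c z,
  [/\ z \in OD, y = dual_lift b c + hecke_entry x * z & maxid y.1 -> b = 0].
Proof.
move=> xO; rewrite dual_integralE => /andP[y1O y2O].
have p0 := uniformizer_neq0 p_unif.
pose b := res_class y.1; pose z1 := (y.1 - res_lift b) / p.
have z1O : z1 \in O by apply: maxid_div => //; exact: res_lift_class.
pose w := y.2 - x * z1; have wO : w \in O by rewrite rpredB // rpredM.
pose c := res_class w; pose z2 := (w - res_lift c) / p.
have z2O : z2 \in O by apply: maxid_div => //; exact: res_lift_class.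
exists b, c, ((z1, z2) : D); split.
- by rewrite dual_integralE /= z1O.
- rewrite [y]surjective_pairing; congr pair => /=; rewrite [p * _]mulrC divfK //; first by ring.
  by rewrite /w; ring.
- move=> y1; apply: res_lift_inj; apply: maxidB; last exact: res_lift0.
  rewrite -[res_lift b](subKr y.1); apply: maxidB => //; exact: res_lift_class.
Qed.

(** First components agree modulo p, so b = b'; this forces z.1 = 0, and the term in x drops out of
    the second component. *)
Lemma dual_lift_inj x b c b' c' (z : D) : z \in OD ->
  dual_lift b c = dual_lift b' c' + hecke_entry x * z -> b = b' /\ c = c'.
Proof.
rewrite dual_integralE => /andP[z1O z2O] E.
have := congr1 fst E; have := congr1 snd E; rewrite /= => E2 E1.
have bb' : b = b' by apply: res_lift_inj; rewrite E1 addrC addKr; exact: maxid_mulp.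
have z10 : z.1 = 0.
  apply: (mulfI (uniformizer_neq0 p_unif)); rewrite mulr0.
  by apply: (addrI (res_lift b')); rewrite -E1 bb' addr0.
split=> //; apply: res_lift_inj; rewrite E2 z10 mulr0 addr0 addrC addKr.
exact: maxid_mulp.
Qed.

Lemma hecke_entry_unit (x : F) : hecke_entry x \is a GRing.unit.
Proof. by rewrite dual_unitE; exact: uniformizer_neq0. Qed.

Lemma hecke_entry_integral x : x \in O -> hecke_entry x \in OD.
Proof.
by move=> xO; rewrite dual_integralE /= xO andbT maxidW //; exact: maxid_uniformizer.
Qed.

(** The bottom rows give N_10 = 0 and s N_11 = 1, the upper left entries s N_00 = 1. The upper right
    entries then read u = u' + t s N_01, and remainders are unique. *)
Lemma coset_rep_inj_same x b c b' c' (s : D) (N V : 'M[D]_2) :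
  N \is a mxOver OD -> V \is a mxOver OD -> V *m N = 1%:M ->
  mx2 (hecke_entry x) (dual_lift b c) 0 1 =
    s *: (mx2 (hecke_entry x) (dual_lift b' c') 0 1 *m N) ->
  b = b' /\ c = c'.
Proof.
set t := hecke_entry x; set u := dual_lift b c; set u' := dual_lift b' c'.
move=> /mxOverP NO /mxOverP VO VN E.
have Eij i j : mx2 t u 0 1 i j = s * (mx2 t u' 0 1 i 0 * N 0 j + mx2 t u' 0 1 i 1 * N 1 j).
  by rewrite -mulmx2E E mxE.
have := Eij 1 1; have := Eij 1 0; have := Eij 0 1; have := Eij 0 0.
rewrite !mx2E !mul0r !mul1r !add0r => E00 E01 E10 E11.
have N10 : N 1 0 = 0 by rewrite -[N 1 0]mul1r E11 mulrAC -E10 mul0r.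
have sN00 : s * N 0 0 = 1.
  apply: (mulrI (hecke_entry_unit x)); rewrite mulr1 -/t [RHS]E00 N10; ring.
have VN00 : V 0 0 * N 0 0 = 1.
  have /matrixP/(_ 0 0) := VN; rewrite mulmx2E N10 mulr0 addr0 => ->.
  by rewrite mxE.
(* [s] and [V 0 0] are both inverse to [N 0 0], and [V] is integral. *)
have sO : s \in OD.
  suff -> : s = V 0 0 by [].
  by rewrite -[s]mul1r -VN00 -mulrA [N 0 0 * s]mulrC sN00 mulr1.
apply: (@dual_lift_inj x _ _ _ _ (s * N 0 1)); first exact: rpredM.
rewrite -/t -/u -/u' E01 mulrDr addrC; congr (_ + _); last by rewrite mulrCA.
by rewrite mulrCA -E11 mulr1.
Qed.

(** Equality would make the bottom row of [N] equal to w (t, u) with the first component of w in the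
    maximal ideal, so [N] would have no integral inverse. *)
Lemma coset_rep_inj_swap x b c u' (s : D) (N V : 'M[D]_2) :
  maxid u'.1 -> x \in O -> u' \in OD ->
  N \is a mxOver OD -> V \is a mxOver OD -> N *m V = 1%:M ->
  mx2 (hecke_entry x) (dual_lift b c) 0 1 <> s *: (mx2 0 1 (hecke_entry x) u' *m N).
Proof.
set t := hecke_entry x; set u := dual_lift b c.
move=> mu' xO u'O /mxOverP NO /mxOverP VO NV E.
have tO : t \in OD := hecke_entry_integral xO.
have Eij i j : mx2 t u 0 1 i j = s * (mx2 0 1 t u' i 0 * N 0 j + mx2 0 1 t u' i 1 * N 1 j).
  by rewrite -mulmx2E E mxE.
have := Eij 1 1; have := Eij 0 1; have := Eij 0 0.
rewrite !mx2E !mul0r !mul1r !add0r => E00 E01.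
set w := t * N 0 1 + _ => sw.
have ws : w * s = 1 by rewrite mulrC -sw.
have mw : maxid w.1.
  have -> : w.1 = t.1 * (N 0 1).1 + u'.1 * (N 1 1).1 by [].
  have /andP[N01 _] := NO 0 1; have /andP[N11 _] := NO 1 1.
  by apply: maxidD; apply: maxidMr => //; exact: maxid_uniformizer.
have N1 : N 1 0 = w * t by rewrite E00 mulrA ws mul1r.
have N2 : N 1 1 = w * u by rewrite E01 mulrA ws mul1r.
have : (N *m V) 1 1 = 1 by rewrite NV mxE.
rewrite mulmx2E N1 N2 -!mulrA -mulrDr => /(congr1 fst).
set r := t * V 0 1 + _.
have rO : r \in OD by rewrite rpredD // rpredM // dual_lift_integral.
rewrite dual_mul_fst => w1.
have : maxid (w.1 * r.1) by apply: maxidMr => //; have /andP[] := rO.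
by rewrite w1 maxid1.
Qed.

Lemma coset_rep_inj x i b c i' b' c' (N V : 'M[D]_2) s : x \in O ->
  coset_index (i, b) -> coset_index (i', b') ->
  N \is a mxOver OD -> V \is a mxOver OD -> V *m N = 1%:M -> N *m V = 1%:M ->
  s \is a GRing.unit ->
  coset_rep x i b c = s *: (coset_rep x i' b' c' *m N) ->
  (i, b, c) = (i', b', c').
Proof.
move=> xO ib ib' NO VO VN NV su.
pose w : 'M[D]_2 := mx2 0 1 1 0.
have wE t u : mx2 0 1 t u = w *m mx2 t u 0 1.
  by rewrite mx2M; congr mx2; ring.
have ww : w *m w = 1%:M by rewrite mx2M mx2_1; congr mx2; ring.
have lift0 d : maxid (dual_lift 0 d).1 by exact: res_lift0.
case: i ib => ib; case: i' ib' => ib' E.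
(* Both swapped: left multiplication by the Weyl element removes the swap. *)
- have [] := @coset_rep_inj_same x b c b' c' s N V NO VO VN; last by move=> -> ->.
  move: E; rewrite /coset_rep !wE => /(congr1 (mulmx w)).
  by rewrite -scalemxAr -!mulmxA !(mulmxA w w) ww !mul1mx.
(* Mixed case in the wrong order: inverting the relation exchanges [N] and [V]. *)
- move/(_ isT): ib => /= b0; move: E; rewrite b0 /coset_rep => E.
  have [] := @coset_rep_inj_swap x b' c' (dual_lift 0 c) s^-1 V N (lift0 _) xO
    (dual_lift_integral _ _) VO NO VN.
  by rewrite E -scalemxAl scalerA mulVr // scale1r -mulmxA NV mulmx1.
- move/(_ isT): ib' => /= b0; move: E; rewrite b0.
  by move=> /(coset_rep_inj_swap (lift0 _) xO (dual_lift_integral _ _) NO VO NV).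
- by have [-> ->] := @coset_rep_inj_same x b c b' c' s N V NO VO VN E.
Qed.

(** Taking out diag(t, 1) leaves a unipotent matrix, with its rows swapped when [i] holds. This puts
    the representative in the double coset. *)
Lemma coset_rep_unitriangular x i b c : exists2 k : 'M[D]_2,
  k \is a mxOver OD /\ ~~ maxid (\det k).1 &
  coset_rep x i b c = k *m mx2 (hecke_entry x) 0 0 1.
Proof.
have lO := dual_lift_integral b c; have O0 : (0 : D) \in OD := rpred0 _.
have O1 : (1 : D) \in OD := rpred1 _.
exists (if i then mx2 0 1 1 (dual_lift b c) else mx2 1 (dual_lift b c) 0 1).
  case: i; split; rewrite ?mxOver_mx2 // det_mx2.
    by rewrite mul0r mul1r sub0r maxidN maxid1.
  by rewrite mul1r mulr0 subr0 maxid1.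
by rewrite /coset_rep; case: i; rewrite mx2M; congr mx2; ring.
Qed.

(** The entry to extract is the remainder of b / d modulo t; what is left is integral. The clause on
    [u] serves the swapped case, where the residue class must be 0. *)
Lemma coset_rep_lower_unit x (a b c d : D) : x \in O ->
  a \in OD -> b \in OD -> c \in OD -> d \in OD -> ~~ maxid d.1 ->
  exists u v (l : 'M[D]_2), [/\ l \is a mxOver OD, \det l = a * d - b * c,
    maxid b.1 -> u = 0 &
    mx2 (a * hecke_entry x) b (c * hecke_entry x) d =
      mx2 (hecke_entry x) (dual_lift u v) 0 1 *m l].
Proof.
move=> xO aO bO cO dO md; set t := hecke_entry x.
have du : d \is a GRing.unit.
  by rewrite dual_unitE; have [] := unit_valring (proj1 (andP dO)) md.
have dVO := dual_integralV dO md.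
have [u [v [z [zO bE ub]]]] := dual_divmod xO (rpredM bO dVO).
have {}bE : b = (dual_lift u v + t * z) * d by rewrite -bE divrK.
exists u, v, (mx2 (a - dual_lift u v * c) (d * z) (c * t) d); split.
- have lO := dual_lift_integral u v; have tO := hecke_entry_integral xO.
  by apply: mxOver_mx2; rewrite ?rpredB ?rpredM.
- by rewrite det_mx2 bE; ring.
- move=> mb; apply: ub; apply: maxidMr => //; exact: (proj1 (andP dVO)).
- by rewrite mx2M bE; congr mx2; ring.
Qed.

(** The last column of [k] contains a unit because the determinant is one. If the lower entry is not
    a unit, the rows are swapped; that entry then sits on top, in the maximal ideal, and its residue
    class is 0. *)
Lemma coset_rep_surj x (k : 'M[D]_2) : x \in O ->
  k \is a mxOver OD -> ~~ maxid (\det k).1 ->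
  exists i b c (l : 'M[D]_2), [/\ coset_index (i, b), l \is a mxOver OD,
    ~~ maxid (\det l).1 &
    k *m mx2 (hecke_entry x) 0 0 1 = coset_rep x i b c *m l].
Proof.
move=> xO /mxOverP kO; rewrite [k]mx2_eta det_mx2.
set a := k 0 0; set b := k 0 1; set c := k 1 0; set d := k 1 1 => dk.
have kE : mx2 a b c d *m mx2 (hecke_entry x) 0 0 1 =
  mx2 (a * hecke_entry x) b (c * hecke_entry x) d.
  by rewrite mx2M; congr mx2; ring.
have [md|md] := boolP (maxid d.1); last first.
  have [u [v [l [lO dl _ E]]]] :=
    coset_rep_lower_unit xO (kO 0 0) (kO 0 1) (kO 1 0) (kO 1 1) md.
  by exists false, u, v, l; split; rewrite ?kE ?dl.
have mb : ~~ maxid b.1.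
  apply: contraNN dk => mb; apply: maxidB.
    by apply: maxidMl => //; exact: (proj1 (andP (kO 0 0))).
  by apply: maxidMr => //; exact: (proj1 (andP (kO 1 0))).
have [u [v [l [lO dl ub E]]]] :=
  coset_rep_lower_unit xO (kO 1 0) (kO 1 1) (kO 0 0) (kO 0 1) mb.
exists true, u, v, l; split=> //.
- by move=> _; exact: ub.
- by rewrite dl -/a -/b -/c -/d -opprB maxidN [d * a]mulrC [c * b]mulrC.
have wE (e f g h : D) : mx2 e f g h = mx2 0 1 1 0 *m mx2 g h e f.
  by rewrite mx2M; congr mx2; ring.
by rewrite kE wE E mulmxA /coset_rep -wE.
Qed.

End Cosets.

(** * The Hecke operator as an explicit finite sum *)

Section HeckeSum.
Variables (F : localFieldType) (p : F).
Hypothesis p_unif : uniformizer p.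
Local Notation D := (dualnum F).
Local Notation OD := (@dual_integral F).
Local Notation kappa := (residue_field F).
Local Notation K := (@Keps F).

Definition hecke_coset (x : kappa) (a : (bool * kappa) * kappa) : set (PGL2 D) :=
  [set (pgl (coset_rep p (res_lift x) a.1.1 a.1.2 a.2) * k)%g | k in K].

Lemma unit_of_det_integral (k : 'M[D]_2) : k \is a mxOver OD -> ~~ maxid (\det k).1 ->
  k \in unitmx.
Proof.
move=> kO dk; rewrite unitmxE dual_unitE.
by have [] := unit_valring (proj1 (andP (det_integral kO))) dk.
Qed.

Lemma hecke_coset_bij (x : kappa) :
  set_bij (@coset_index F `*` setT) (left_cosets_in K (double_coset K (hecke_elt p x)))
    (hecke_coset x).
Proof.
have xO := res_lift_valring x.
have gu : mx2 (hecke_entry p (res_lift x)) 0 0 1 \in unitmx.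
  by rewrite unitmxE det_mx2 mulr1 mulr0 subr0 hecke_entry_unit.
split.
- move=> [[i b] c] _; split; last by exists (pgl (coset_rep p (res_lift x) i b c)).
  have [k [kO dk] E] := coset_rep_unitriangular p (res_lift x) i b c.
  have ku := unit_of_det_integral kO dk.
  move=> _ [l Kl <-]; exists (pgl k); first exact: Keps_pgl.
  exists l; first exact: Kl.
  by rewrite /= hecke_eltE E (mul_pgl ku gu).
(* Injectivity: equal cosets give a matrix equation up to a unit scalar [s]. *)
- move=> [[i b] c] [[i' b'] c'] /set_mem[ib _] /set_mem[ib' _] /Keps_coset[_ [N [Nu NO VO ->]]].
  have ru := coset_rep_unit p_unif (res_lift x).
  rewrite /= (mul_pgl (ru _ _ _) Nu) => /pgl_eqP E.
  have [||s su {}E] := E; rewrite ?unitmx_mul ?ru ?Nu //.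
  exact: (coset_rep_inj p_unif xO ib ib' NO VO (mulVmx Nu) (mulmxV Nu) su E).
(* Surjectivity: in g = k1 g_x k2 only k1 has to be decomposed, since k2 is absorbed by the
   coset. *)
- move=> C [CD [g CE]].
  have : C g by rewrite CE; exists 1%g; [exact: Keps1 | exact: mulg1].
  move=> /CD [k1 [M [Mu MO VO k1E]] [k2 Kk2 gE]].
  have dM : ~~ maxid (\det M).1.
    have /(congr1 fst) : \det M * \det (invmx M) = 1 by rewrite -det_mulmx mulmxV // det1.
    rewrite dual_mul_fst => dd; apply/negP => mM.
    have : maxid ((\det M).1 * (\det (invmx M)).1).
      by apply: maxidMr => //; exact: (proj1 (andP (det_integral VO))).
    by rewrite dd maxid1.
  have [i [b [c [l [ib lO dl E]]]]] := coset_rep_surj p_unif xO MO dM.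
  exists ((i, b), c); first by split.
  have lu := unit_of_det_integral lO dl.
  rewrite CE; apply: esym; apply/Keps_coset; exists (pgl l * k2)%g.
    by apply: KepsM => //; exact: Keps_pgl.
  have ru := coset_rep_unit p_unif (res_lift x) i b c.
  by rewrite -gE k1E hecke_eltE (mul_pgl Mu gu) E -(mul_pgl ru lu) -mulgA.
Qed.

Lemma finite_coset_index : finite_set (@coset_index F).
Proof.
apply: (@sub_finite_set _ _ ([set: bool] `*` [set: kappa])); first by [].
apply: finite_setX; [exact: finite_finset | exact: finite_residue_field].
Qed.

(** The element picked by [xget] differs from the representative by a right factor in [Keps], which
    [f] absorbs. The sum over [c] is kept innermost, where the dependence on [x] disappears. *)
Lemma hecke_sum (R : realType) (W : lmodType R[i]) (x : kappa) (f : PGL2 D -> W) :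
  (forall k, K k -> rtrans k f = f) -> forall g,
  hecke p x f g = (residue_card F)%:R^-1 *:
    \sum_(ib \in @coset_index F) \sum_(c \in [set: kappa])
      f (g * pgl (coset_rep p (res_lift x) ib.1 ib.2 c))%g.
Proof.
move=> fK g; rewrite /hecke; congr (_ *: _).
rewrite (pair_fsbig _ _ finite_coset_index (finite_residue_field F)).
rewrite (reindex_fsbig _ _ _ _ (hecke_coset_bij x)); apply: eq_fsbigr => -[[i b] c] _ /=.
have : hecke_coset x (i, b, c) (xget 1%g (hecke_coset x (i, b, c))).
  apply: (@xgetPex _ 1%g); exists (pgl (coset_rep p (res_lift x) i b c)); exists 1%g.
    exact: Keps1.
  exact: mulg1.
case=> k Kk <-; rewrite /rtrans mulgA.
exact: (congr1 (fun h => h _) (fK _ Kk)).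
Qed.

End HeckeSum.

Theorem lemma3p3 (R : realType) (F : localFieldType)
    (charF : 2%N \notin [pchar F])
    (p : F) (p_unif : uniformizer p)
    (psi0 : F -> R[i]) (psi0_char : additive_character psi0)
    (psi0_cond : conductor_integral psi0)
    (m : 'M[F]_2) (m_sl2 : \tr m = 0)
    (W : lmodType R[i]) (rho : PGL2 F -> W -> W)
    (rho_rep : is_rep (stabilizer m) rho)
    (rho_smooth : smooth_rep (stabilizer m) rho)
    (rho_irr : irreducible_rep (stabilizer m) rho)
    (det_m : (1%:E <= valuation (\det m))%E) :
  forall (x y : residue_field F) (f : PGL2 (dualnum F) -> W),
    Vfixed psi0 m rho f -> hecke p x f = hecke p y f.
Proof.
move=> x y f fV; have [_ fK] := fV; apply/funext => g.
apply: (etrans (hecke_sum p_unif x fK g)); apply: (etrans _ (esym (hecke_sum p_unif y fK g))).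
apply: (congr1 (fun w => _ *: w)).
apply: eq_fsbigr => -[i b] _.
(* Each inner sum is unchanged when x / p is replaced by 0, which leaves an expression free of
   [z]. *)
have sumE (z : residue_field F) : \sum_(c \in [set: residue_field F])
    f (g * pgl (coset_rep p (res_lift z) i b c))%g =
  \sum_(c \in [set: residue_field F])
    f (g * pgl (dmx (if i then mx2 0 1 p (res_lift b) else mx2 p (res_lift b) 0 1) 0) *
       one_plus_eps (mx2 0 (res_lift c / p) 0 0))%g.
  have inner := hecke_inner_sum charF p_unif psi0_char psi0_cond m_sl2 det_m fV _
    (res_lift_valring z).
  apply: etrans (inner _); apply: eq_fsbigr => c _; apply: (congr1 f).
  by apply: etrans (mulgA _ _ _); apply: (congr1 (fun h => g * h)%g); exact: coset_rep_one_plus_eps.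
exact: (etrans (sumE x) (esym (sumE y))).
Qed.
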